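(* Let $c=a/(1+a^2)$ with $0<a\le1$. For $z\in\mathbb C$ let $G(z)=z-\sqrt{z^2+2c}$, with the branch of the square root specified in the context, and let $\mathcal Q^+=\{z\in\mathbb C:\Re(z)>0,\ \Im(z)>0\}$. With the convention that $\arg(\cdot)$ ranges from $-\pi/2$ to $3\pi/2$, the mapping $$z\in\mathcal Q^+\mapsto (X(z),Y(z))=(\arg G(z),\arg G(1/z))$$ is a diffeomorphism from $\mathcal Q^+$ to $(\pi/2,\pi)\times(\pi,3\pi/2)$. Denote its inverse by $(X,Y)\mapsto z(X,Y)$. Moreover, for $0<\rho_-,\rho_+<\pi$, the speed of growth $v(\rho)$ is equivalently given by $$v(\rho)=\frac X\pi-1+\frac1\pi\arg z(X,Y),\qquad X=\frac{\rho_-}2+\frac\pi2\in(\pi/2,\pi),\quad Y=-\frac{\rho_+}2+\frac32\pi\in(\pi,3\pi/2).$$ (The other three cases $-\pi<\rho_-<0<\rho_+<\pi$, $-\pi<\rho_+<0<\rho_-<\pi$ and $-\pi<\rho_-,\rho_+<0$ are obtained by the symmetries $v(\rho_1,\rho_2)=-v(\rho_2,\rho_1)$ and $v(\rho_1,\rho_2)=\rho_1-\rho_2-v(-\rho_2,-\rho_1)$.)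
   Context: Square root: for $w\in\mathbb C\setminus \mathrm i[-\sqrt{2c},\sqrt{2c}]$, $\sqrt{w^2+2c}=\exp\!\big(\tfrac12\log(w+\mathrm i\sqrt{2c})+\tfrac12\log(w-\mathrm i\sqrt{2c})\big)$, the logarithms taking arguments in $(-\pi/2,3\pi/2)$. (For $w>0$ it is the positive root.) Slopes: $\rho=(\rho_1,\rho_2)$ lies in the interior of the square with vertices $(\pm1,0),(0,\pm1)$; $\rho_+=\pi(\rho_1+\rho_2)$, $\rho_-=\pi(\rho_1-\rho_2)$. The function $v$ is the function $$v(\rho)=\frac{\rho_-}{2\pi}-\frac{\pi-\arccos\Sigma}{2\pi}\,\mathrm{sign}(\rho_-\rho_+),$$ $$\Sigma=-\frac{\cos\rho_-+\cos\rho_++\sqrt{(\cos\rho_--\cos\rho_+)^2+4c^2\sin^2\rho_-\sin^2\rho_+}}2,\qquad \arccos\Sigma\in[0,\pi].$$ *)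

(* Defs.v *)
From Stdlib Require Import Reals Lra.
From Coquelicot Require Import Coquelicot.

Open Scope R_scope.

(** [Carg z] is the argument of [z] in [-PI/2, 3 * PI/2), with [Carg 0 = 0];
    see [Carg_spec] and [Carg_unique].  The end point -PI/2 is attained only
    on the negative imaginary axis. *)
Definition Carg (z : C) : R :=
  match total_order_T 0 (Re z) with
  | inleft (left _) => atan (Im z / Re z)
  | inleft (right _) => sign (Im z) * (PI / 2)
  | inright _ => atan (Im z / Re z) + PI
  end.

Lemma cos_sin_atan_div (x y : R) : x <> 0 ->
  Rabs x = sqrt (x ^ 2 + y ^ 2) * cos (atan (y / x)) /\
  Rabs x * y = sqrt (x ^ 2 + y ^ 2) * x * sin (atan (y / x)).
Proof.
intros Hx.
assert (H2 : 0 < x ^ 2) by (apply pow2_gt_0; exact Hx).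
assert (Ha : 0 < Rabs x) by (apply Rabs_pos_lt; exact Hx).
assert (H1 : 0 < 1 + (y / x)²) by (generalize (Rle_0_sqr (y / x)); lra).
assert (Hs : sqrt (x ^ 2 + y ^ 2) = Rabs x * sqrt (1 + (y / x)²)).
{ replace (x ^ 2 + y ^ 2) with (x² * (1 + (y / x)²)).
  - rewrite sqrt_mult by (generalize (Rle_0_sqr x); lra).
    now rewrite sqrt_Rsqr_abs.
  - unfold Rsqr; field; exact Hx. }
assert (Hp := sqrt_lt_R0 _ H1).
rewrite cos_atan, sin_atan, Hs.
split; field; repeat split; lra.
Qed.

Lemma Carg_spec (z : C) : z <> RtoC 0 ->
  - (PI / 2) <= Carg z < 3 * PI / 2 /\
  Re z = Cmod z * cos (Carg z) /\ Im z = Cmod z * sin (Carg z).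
Proof.
destruct z as [x y]; intros Hz; unfold Carg, Cmod; simpl fst; simpl snd.
unfold Re, Im; simpl fst; simpl snd.
assert (HP := PI_RGT_0).
destruct (total_order_T 0 x) as [[Hx | Hx] | Hx].
- assert (Hx0 : x <> 0) by lra.
  destruct (cos_sin_atan_div x y Hx0) as [Hc Hs].
  rewrite Rabs_pos_eq in Hc, Hs by lra.
  assert (Hb := atan_bound (y / x)).
  split; [lra | split; [exact Hc |]].
  apply (Rmult_eq_reg_l x); [lra | exact Hx0].
- subst x.
  assert (Hy0 : y <> 0) by (intros ->; now apply Hz).
  replace (0 ^ 2 + y ^ 2) with (y²) by (unfold Rsqr; ring).
  rewrite sqrt_Rsqr_abs.
  unfold sign; destruct (total_order_T 0 y) as [[Hy | Hy] | Hy]; [| lra |].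
  + rewrite Rabs_pos_eq, Rmult_1_l, cos_PI2, sin_PI2 by lra; lra.
  + rewrite Rabs_left by lra.
    replace (-1 * (PI / 2)) with (- (PI / 2)) by ring.
    rewrite cos_neg, sin_neg, cos_PI2, sin_PI2; lra.
- assert (Hx0 : x <> 0) by lra.
  destruct (cos_sin_atan_div x y Hx0) as [Hc Hs].
  rewrite Rabs_left in Hc, Hs by lra.
  assert (Hb := atan_bound (y / x)).
  rewrite neg_cos, neg_sin.
  split; [lra | split; [lra |]].
  apply (Rmult_eq_reg_l x); [lra | exact Hx0].
Qed.

Lemma Carg_unique (z : C) (t : R) : z <> RtoC 0 ->
  - (PI / 2) <= t < 3 * PI / 2 ->
  Re z = Cmod z * cos t -> Im z = Cmod z * sin t -> t = Carg z.
Proof.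
intros Hz Ht Hre Him.
destruct (Carg_spec z Hz) as [Hs [Hre' Him']].
assert (Hm : Cmod z <> 0) by (apply Rgt_not_eq, Cmod_gt_0; exact Hz).
assert (Ec : cos t = cos (Carg z)).
{ apply (Rmult_eq_reg_l (Cmod z)); [congruence | exact Hm]. }
assert (Es : sin t = sin (Carg z)).
{ apply (Rmult_eq_reg_l (Cmod z)); [congruence | exact Hm]. }
set (d := (t - Carg z) / 2).
assert (Hd : sin d = 0).
{ assert (H : cos (2 * d) = 1).
  { replace (2 * d) with (t - Carg z) by (unfold d; field).
    rewrite cos_minus, Ec, Es.
    generalize (sin2_cos2 (Carg z)); unfold Rsqr; lra. }
  rewrite cos_2a_sin in H.
  apply Rsqr_0_uniq; unfold Rsqr; lra. }
assert (Hb : - PI < d < PI) by (unfold d; lra).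
destruct (Rtotal_order d 0) as [H | [H | H]].
- assert (0 < sin (- d)) by (apply sin_gt_0; lra).
  rewrite sin_neg in *; lra.
- unfold d in H; lra.
- assert (0 < sin d) by (apply sin_gt_0; lra); lra.
Qed.

Definition Cexp (z : C) : C := (exp (Re z) * cos (Im z), exp (Re z) * sin (Im z)).

Definition Clog (z : C) : C := (ln (Cmod z), Carg z).

(** The branch of [sqrt (w^2 + 2c)] cut along [i[-sqrt(2c), sqrt(2c)]]; the
    value on the cut is meaningless. *)
Definition Csqrt_shift (c : R) (w : C) : C :=
  Cexp (RtoC (1 / 2) * Clog (w + Ci * RtoC (sqrt (2 * c)))
        + RtoC (1 / 2) * Clog (w - Ci * RtoC (sqrt (2 * c))))%C.

Definition G (c : R) (z : C) : C := (z - Csqrt_shift c z)%C.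

Definition Qplus (z : C) : Prop := 0 < Re z /\ 0 < Im z.

Definition XY (c : R) (z : C) : R * R := (Carg (G c z), Carg (G c (RtoC 1 / z)%C)).

Definition XYrange (p : R * R) : Prop :=
  PI / 2 < fst p < PI /\ PI < snd p < 3 * PI / 2.

(** C^infinity on an open set [U] of the plane: at every point of [U], partial
    derivatives of all orders exist and are continuous.  Since C is
    [R * R] in Coquelicot, this also applies to maps from or to C. *)
Definition smooth_on (U : R * R -> Prop) (f : R * R -> R * R) : Prop :=
  forall (n : nat) (x y : R), U (x, y) ->
    ex_diff_n (fun u v => fst (f (u, v))) n x y /\
    ex_diff_n (fun u v => snd (f (u, v))) n x y.

(** [f] restricts to a diffeomorphism from [U] onto [V], with inverse [g]. *)
Definition diffeomorphism (U V : R * R -> Prop) (f g : R * R -> R * R) : Prop :=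
  (forall p, U p -> V (f p)) /\ (forall q, V q -> U (g q)) /\
  (forall p, U p -> g (f p) = p) /\ (forall q, V q -> f (g q) = q) /\
  smooth_on U f /\ smooth_on V g.

Definition rho_plus (rho : R * R) : R := PI * (fst rho + snd rho).
Definition rho_minus (rho : R * R) : R := PI * (fst rho - snd rho).

(** The interior of the square with vertices (+-1, 0), (0, +-1). *)
Definition slope (rho : R * R) : Prop := Rabs (fst rho) + Rabs (snd rho) < 1.

Definition Sigma (c : R) (rho : R * R) : R :=
  - ((cos (rho_minus rho) + cos (rho_plus rho)
      + sqrt ((cos (rho_minus rho) - cos (rho_plus rho)) ^ 2
              + 4 * c ^ 2 * sin (rho_minus rho) ^ 2 * sin (rho_plus rho) ^ 2)) / 2).

Definition v (c : R) (rho : R * R) : R :=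
  rho_minus rho / (2 * PI)
  - (PI - acos (Sigma c rho)) / (2 * PI) * sign (rho_minus rho * rho_plus rho).

Definition Xrho (rho : R * R) : R := rho_minus rho / 2 + PI / 2.
Definition Yrho (rho : R * R) : R := - (rho_plus rho / 2) + 3 / 2 * PI.

(** The expression of the speed through the map [zXY : (X, Y) |-> z]. *)
Definition v_alt (zXY : R * R -> C) (rho : R * R) : R :=
  Xrho rho / PI - 1 + 1 / PI * Carg (zXY (Xrho rho, Yrho rho)).

(* Main.v *)
(** Write [s] for the square root of [z^2 + 2 c] with positive real part [p], for
    [z = x + i y] with [0 < x].  Then [p > x] and [Im s = x y / p], so that
    [arg G(z) = PI - atan (y / p)], and [theta = arg G(z)] is the only angle of
    its quadrant with [y^2 / sin^2 theta - x^2 / cos^2 theta = 2 c].  Put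
    [m = |z|^2], [T = cos (2 arg z)], [u = cos (2 X)], [w = cos (2 Y)]; the
    equations for [z] and [1/z] become [m (u - T) = c (1 - u^2)] and
    [w - T = c m (1 - w^2)].  Their product
    [(u - T) (w - T) = c^2 (1 - u^2) (1 - w^2)] is quadratic in [T], and [m > 0]
    selects its smaller root; this inverts the map explicitly.  At the [X], [Y]
    of the theorem the smaller root is [Sigma], hence [arg z = acos Sigma / 2]. *)

Require Import Defs.
From Stdlib Require Import Reals Lra.
From Coquelicot Require Import Coquelicot.
Open Scope R_scope.

(** * Smoothness of finite order on a plane set and its closure rules *)

(** The partial derivatives are existential witnesses constrained on [U] only, so each closure rule
    supplies explicit formulas for them; [ex_diff_n] speaks of [Derive] instead and is recovered on
    open sets by [smooth_n_ex_diff_n]. *)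
Fixpoint smooth_n (U : R * R -> Prop) (n : nat) (f : R -> R -> R) : Prop :=
  (forall x y, U (x, y) -> continuity_2d_pt f x y) /\
  match n with
  | O => True
  | S m => exists fx fy : R -> R -> R,
      (forall x y, U (x, y) ->
         is_derive (fun t => f t y) x (fx x y) /\
         is_derive (fun t => f x t) y (fy x y)) /\
      smooth_n U m fx /\ smooth_n U m fy
  end.

Section Smooth.

Variable U : R * R -> Prop.

(** For the product and chain rules: the derivatives there contain the original functions, to which
    the induction hypothesis applies at one order less. *)
Lemma smooth_n_pred n f : smooth_n U (S n) f -> smooth_n U n f.
Proof.
revert f; induction n as [|n IH]; intros f [Hc H]; (split; [exact Hc|]).
- exact I.
- destruct H as [fx [fy [Hd [Hx Hy]]]].
  exists fx, fy; auto.
Qed.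

Lemma smooth_n_const n k : smooth_n U n (fun _ _ => k).
Proof.
revert k; induction n as [|n IH]; intros k; split;
  try (intros; apply continuity_2d_pt_const); [exact I|].
exists (fun _ _ => 0), (fun _ _ => 0).
split; [|split; apply IH].
intros x y _; split; apply (is_derive_const (V := R_NormedModule)).
Qed.

Lemma smooth_n_fst n : smooth_n U n (fun x _ => x).
Proof.
destruct n as [|n]; split; try (intros; apply continuity_2d_pt_id1); [exact I|].
exists (fun _ _ => 1), (fun _ _ => 0).
split; [|split; apply smooth_n_const].
intros x y _; split; [apply (is_derive_id x) | apply (is_derive_const (V := R_NormedModule))].
Qed.

Lemma smooth_n_snd n : smooth_n U n (fun _ y => y).
Proof.
destruct n as [|n]; split; try (intros; apply continuity_2d_pt_id2); [exact I|].
exists (fun _ _ => 0), (fun _ _ => 1).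
split; [|split; apply smooth_n_const].
intros x y _; split; [apply (is_derive_const (V := R_NormedModule)) | apply (is_derive_id y)].
Qed.

Lemma smooth_n_plus n f g :
  smooth_n U n f -> smooth_n U n g -> smooth_n U n (fun x y => f x y + g x y).
Proof.
revert f g; induction n as [|n IH]; intros f g [Cf Hf] [Cg Hg]; split;
  try (intros x y HU; apply continuity_2d_pt_plus; auto); [exact I|].
destruct Hf as [fx [fy [Df [Hfx Hfy]]]], Hg as [gx [gy [Dg [Hgx Hgy]]]].
exists (fun x y => fx x y + gx x y), (fun x y => fy x y + gy x y).
split; [|split; apply IH; assumption].
intros x y HU; destruct (Df x y HU), (Dg x y HU).
split; apply (is_derive_plus (V := R_NormedModule)); assumption.
Qed.

Lemma smooth_n_mult n f g :
  smooth_n U n f -> smooth_n U n g -> smooth_n U n (fun x y => f x y * g x y).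
Proof.
revert f g; induction n as [|n IH]; intros f g Sf Sg;
  assert (Sf' := Sf); assert (Sg' := Sg);
  destruct Sf as [Cf Hf], Sg as [Cg Hg]; split;
  try (intros x y HU; apply continuity_2d_pt_mult; auto); [exact I|].
apply smooth_n_pred in Sf'; apply smooth_n_pred in Sg'.
destruct Hf as [fx [fy [Df [Hfx Hfy]]]], Hg as [gx [gy [Dg [Hgx Hgy]]]].
exists (fun x y => fx x y * g x y + f x y * gx x y),
  (fun x y => fy x y * g x y + f x y * gy x y).
split; [|split; apply smooth_n_plus; apply IH; assumption].
intros x y HU; destruct (Df x y HU), (Dg x y HU).
split.
- apply (is_derive_mult (fun t => f t y) (fun t => g t y)); auto; apply Rmult_comm.
- apply (is_derive_mult (fun t => f x t) (fun t => g x t)); auto; apply Rmult_comm.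
Qed.

(** The hypothesis on [h'] is an induction step: smoothness of order [n] of
    [h o f] for all [f] gives the same for [h' o f].  It accommodates the
    functions whose derivative is expressed through [h] itself. *)
Lemma smooth_n_comp (P : R -> Prop) (h h' : R -> R) :
  (forall t, P t -> is_derive h t (h' t)) ->
  (forall n,
     (forall f, (forall x y, U (x, y) -> P (f x y)) ->
        smooth_n U n f -> smooth_n U n (fun x y => h (f x y))) ->
     forall f, (forall x y, U (x, y) -> P (f x y)) ->
        smooth_n U n f -> smooth_n U n (fun x y => h' (f x y))) ->
  forall n f, (forall x y, U (x, y) -> P (f x y)) ->
    smooth_n U n f -> smooth_n U n (fun x y => h (f x y)).
Proof.
intros Dh Hstep n; induction n as [|n IH]; intros f HP Sf;
  assert (Sf' := Sf); destruct Sf as [Cf Hf]; split;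
  try (intros x y HU; apply continuity_1d_2d_pt_comp; [|auto];
       apply continuity_pt_filterlim, (ex_derive_continuous h);
       exists (h' (f x y)); auto); [exact I|].
apply smooth_n_pred in Sf'.
destruct Hf as [fx [fy [Df [Hfx Hfy]]]].
exists (fun x y => fx x y * h' (f x y)), (fun x y => fy x y * h' (f x y)).
split; [|split; apply smooth_n_mult; auto].
intros x y HU; destruct (Df x y HU).
split.
- apply (is_derive_comp h (fun t => f t y)); auto.
- apply (is_derive_comp h (fun t => f x t)); auto.
Qed.

Lemma smooth_n_inv n f :
  (forall x y, U (x, y) -> f x y <> 0) ->
  smooth_n U n f -> smooth_n U n (fun x y => / f x y).
Proof.
apply (smooth_n_comp (fun t => t <> 0) Rinv (fun t => -1 * (/ t * / t))).
- intros t Ht; auto_derive; [exact Ht | field; exact Ht].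
- intros m H g Hg Sg.
  apply smooth_n_mult; [apply smooth_n_const | apply smooth_n_mult; auto].
Qed.

Lemma smooth_n_sqrt n f :
  (forall x y, U (x, y) -> 0 < f x y) ->
  smooth_n U n f -> smooth_n U n (fun x y => sqrt (f x y)).
Proof.
apply (smooth_n_comp (fun t => 0 < t) sqrt (fun t => / (2 * sqrt t))).
- intros t Ht; auto_derive; [exact Ht |].
  field; apply Rgt_not_eq, sqrt_lt_R0, Ht.
- intros m H g Hg Sg.
  apply smooth_n_inv.
  + intros x y HU; assert (H1 := sqrt_lt_R0 _ (Hg x y HU)); lra.
  + apply smooth_n_mult; [apply smooth_n_const | auto].
Qed.

Lemma smooth_n_atan n f :
  smooth_n U n f -> smooth_n U n (fun x y => atan (f x y)).
Proof.
apply (smooth_n_comp (fun _ => True) atan (fun t => / (1 + t * t))); auto.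
- intros t _; apply is_derive_atan.
- intros m _ g _ Sg.
  apply smooth_n_inv; [intros x y _; nra |].
  apply smooth_n_plus; [apply smooth_n_const | apply smooth_n_mult; auto].
Qed.

Lemma smooth_n_sin n f :
  smooth_n U n f -> smooth_n U n (fun x y => sin (f x y)).
Proof.
(* Writing the derivative of [sin] as a shifted [sin] closes the induction on [sin] alone, without a
   simultaneous statement for [cos]. *)
apply (smooth_n_comp (fun _ => True) sin (fun t => sin (PI / 2 + t))); auto.
- intros t _; rewrite <- cos_sin; apply is_derive_sin.
- intros m H g _ Sg.
  apply (H (fun x y => PI / 2 + g x y)); auto.
  apply smooth_n_plus; [apply smooth_n_const | auto].
Qed.

Lemma smooth_n_cos n f :
  smooth_n U n f -> smooth_n U n (fun x y => cos (f x y)).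
Proof.
apply (smooth_n_comp (fun _ => True) cos (fun t => -1 * sin t)); auto.
- intros t _; auto_derive; [exact I | ring].
- intros m _ g _ Sg.
  apply smooth_n_mult; [apply smooth_n_const | apply smooth_n_sin, Sg].
Qed.

Lemma smooth_n_minus n f g :
  smooth_n U n f -> smooth_n U n g -> smooth_n U n (fun x y => f x y - g x y).
Proof.
revert f g; induction n as [|n IH]; intros f g [Cf Hf] [Cg Hg]; split;
  try (intros x y HU; apply continuity_2d_pt_minus; auto); [exact I|].
destruct Hf as [fx [fy [Df [Hfx Hfy]]]], Hg as [gx [gy [Dg [Hgx Hgy]]]].
exists (fun x y => fx x y - gx x y), (fun x y => fy x y - gy x y).
split; [|split; apply IH; assumption].
intros x y HU; destruct (Df x y HU), (Dg x y HU).
split; apply (is_derive_minus (V := R_NormedModule)); assumption.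
Qed.

Lemma smooth_n_div n f g :
  (forall x y, U (x, y) -> g x y <> 0) ->
  smooth_n U n f -> smooth_n U n g -> smooth_n U n (fun x y => f x y / g x y).
Proof.
intros Hg Sf Sg; apply (smooth_n_mult n f (fun x y => / g x y)); auto.
apply smooth_n_inv; auto.
Qed.

(** The witnesses agree with [Derive] on [U]; openness turns this into agreement on a neighbourhood,
    which is what iterated derivatives see. *)
Lemma smooth_n_ex_diff_n n f x y :
  (forall u v, U (u, v) -> locally_2d (fun u' v' => U (u', v')) u v) ->
  smooth_n U n f -> U (x, y) -> ex_diff_n f n x y.
Proof.
intros HO; revert f x y; induction n as [|n IH]; intros f x y [Cf Hf] HU;
  (split; [apply Cf, HU|]); [exact I|].
destruct Hf as [fx [fy [Df [Hfx Hfy]]]].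
split; [exists (fx x y); apply Df, HU|].
split; [exists (fy x y); apply Df, HU|].
split; [apply (ex_diff_n_ext_loc fx) | apply (ex_diff_n_ext_loc fy)]; auto;
  apply (locally_2d_impl (fun u v => U (u, v))); auto;
  apply locally_2d_forall; intros u v Huv; symmetry;
  apply is_derive_unique, Df, Huv.
Qed.

End Smooth.

Lemma smooth_on_smooth_n (U : R * R -> Prop) (f : R * R -> R * R) (f1 f2 : R -> R -> R) :
  (forall x y, U (x, y) -> locally_2d (fun u v => U (u, v)) x y) ->
  (forall x y, U (x, y) -> f (x, y) = (f1 x y, f2 x y)) ->
  (forall n, smooth_n U n f1) -> (forall n, smooth_n U n f2) ->
  smooth_on U f.
Proof.
intros HO Hf S1 S2 n x y HU; split;
  [apply (ex_diff_n_ext_loc f1) | apply (ex_diff_n_ext_loc f2)];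
  try (apply (smooth_n_ex_diff_n U); auto);
  apply (locally_2d_impl (fun u v => U (u, v))); auto;
  apply locally_2d_forall; intros u v Huv; rewrite Hf by exact Huv; reflexivity.
Qed.

(** * The branch of the square root and the argument of [G] *)

Lemma Cexp_plus (a b : C) : Cexp (a + b)%C = (Cexp a * Cexp b)%C.
Proof.
destruct a as [a1 a2], b as [b1 b2]; unfold Cexp, Cmult, Cplus; simpl.
rewrite exp_plus, cos_plus, sin_plus; f_equal; ring.
Qed.

Lemma Cexp_Clog (z : C) : z <> RtoC 0 -> Cexp (Clog z) = z.
Proof.
intros Hz; destruct (Carg_spec z Hz) as [_ [H1 H2]].
unfold Cexp, Clog; cbn [Re Im fst snd].
rewrite exp_ln by (apply Cmod_gt_0, Hz).
rewrite <- H1, <- H2; destruct z; reflexivity.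
Qed.

Lemma Carg_Re_pos (z : C) : 0 < Re z -> Carg z = atan (Im z / Re z).
Proof.
intros H; unfold Carg.
destruct (total_order_T 0 (Re z)) as [[H' | H'] | H']; lra.
Qed.

Lemma Carg_Re_neg (z : C) : Re z < 0 -> Carg z = atan (Im z / Re z) + PI.
Proof.
intros H; unfold Carg.
destruct (total_order_T 0 (Re z)) as [[H' | H'] | H']; lra.
Qed.

(** Since [Cexp] inverts [Clog] off zero, the square is [(z + i s) (z - i s)] with [s = sqrt (2 c)];
    [0 < Re z] keeps both factors away from zero. *)
Lemma Csqrt_shift_sqr (c : R) (z : C) : 0 <= c -> 0 < Re z ->
  (Csqrt_shift c z * Csqrt_shift c z = z * z + RtoC (2 * c))%C.
Proof.
intros Hc Hz.
assert (Hp : forall s, (z + Ci * RtoC s)%C <> RtoC 0).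
{ intros s E; apply (f_equal Re) in E; destruct z as [x y].
  unfold Re in *; cbn in E, Hz; lra. }
assert (Hm : (z - Ci * RtoC (sqrt (2 * c)))%C <> RtoC 0).
{ replace (z - Ci * RtoC (sqrt (2 * c)))%C
    with (z + Ci * RtoC (- sqrt (2 * c)))%C by (rewrite RtoC_opp; ring).
  apply Hp. }
unfold Csqrt_shift; rewrite <- Cexp_plus.
replace (_ + _)%C with (Clog (z + Ci * RtoC (sqrt (2 * c)))
                        + Clog (z - Ci * RtoC (sqrt (2 * c))))%C.
- rewrite Cexp_plus, !Cexp_Clog by auto.
  assert (Hs := sqrt_sqrt (2 * c)); set (s := sqrt (2 * c)) in *; clearbody s.
  destruct z as [x y]; unfold Cminus, Cmult, Cplus, Copp, RtoC, Ci; cbn [fst snd].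
  rewrite <- Hs by lra; f_equal; ring.
- destruct (Clog (z + Ci * RtoC (sqrt (2 * c)))) as [a1 a2],
    (Clog (z - Ci * RtoC (sqrt (2 * c)))) as [b1 b2].
  unfold Cmult, Cplus, RtoC; cbn [fst snd]; f_equal; field.
Qed.

(** Both logarithms have imaginary part in (-PI/2, PI/2), hence so has their half sum, and [cos] is
    positive there. *)
Lemma Csqrt_shift_Re_pos (c : R) (z : C) :
  0 < Re z -> 0 < Re (Csqrt_shift c z).
Proof.
destruct z as [x y]; intros Hz; unfold Re in Hz; cbn in Hz.
unfold Csqrt_shift, Cexp, Re at 1; cbn [fst].
apply Rmult_lt_0_compat; [apply exp_pos |].
assert (H : forall s, Re ((x, y) + Ci * RtoC s)%C = x) by (intros s; unfold Re; cbn; ring).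
assert (H' : forall s, Re ((x, y) - Ci * RtoC s)%C = x) by (intros s; unfold Re; cbn; ring).
unfold Clog.
rewrite !Carg_Re_pos by (rewrite ?H, ?H'; exact Hz).
set (s := Im _ / _); set (t := Im _ / _).
assert (Hs := atan_bound s); assert (Ht := atan_bound t).
unfold Im; cbn; apply cos_gt_0; lra.
Qed.

(** Real part of [sqrt ((x + i y)^2 + 2 c)] for [0 < x]. *)
Definition sqrt_re (c x y : R) : R :=
  sqrt ((sqrt ((x * x - y * y + 2 * c) * (x * x - y * y + 2 * c)
               + 4 * (x * y * (x * y))) + (x * x - y * y + 2 * c)) / 2).

(** The real part [p > 0] singles out the root [p + i q]: [p^2 - q^2] and [p q] are known, and
    [p^2 + q^2] is the modulus of the square, which gives [p]. *)
Lemma Csqrt_shift_eq (c x y : R) : 0 <= c -> 0 < x ->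
  Csqrt_shift c (x, y) = (sqrt_re c x y, x * y / sqrt_re c x y).
Proof.
intros Hc Hx.
assert (H1 := Csqrt_shift_sqr c (x, y) Hc Hx).
assert (H2 := Csqrt_shift_Re_pos c (x, y) Hx).
destruct (Csqrt_shift c (x, y)) as [p q].
unfold Re in H2; cbn in H2.
unfold Cmult, Cplus, RtoC in H1; cbn [fst snd] in H1.
injection H1 as Hre Him.
assert (Hq : p * q = x * y) by lra.
assert (Hr : p * p - q * q = x * x - y * y + 2 * c) by lra.
assert (Hp : sqrt_re c x y = p).
{ unfold sqrt_re; rewrite <- Hr, <- Hq.
  replace ((p * p - q * q) * (p * p - q * q) + 4 * (p * q * (p * q)))
    with (Rsqr (p * p + q * q)) by (unfold Rsqr; ring).
  rewrite sqrt_Rsqr by nra.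
  replace ((p * p + q * q + (p * p - q * q)) / 2) with (Rsqr p)
    by (unfold Rsqr; field).
  apply sqrt_Rsqr; lra. }
rewrite Hp, <- Hq; f_equal; field; lra.
Qed.

Lemma sqrt_re_spec (c x y : R) : 0 < c -> 0 < x ->
  x < sqrt_re c x y /\
  sqrt_re c x y ^ 4 = (x ^ 2 - y ^ 2 + 2 * c) * sqrt_re c x y ^ 2 + (x * y) ^ 2.
Proof.
intros Hc Hx.
assert (H1 := Csqrt_shift_sqr c (x, y) (Rlt_le _ _ Hc) Hx).
assert (H2 := Csqrt_shift_Re_pos c (x, y) Hx).
rewrite Csqrt_shift_eq in H1, H2 by lra.
set (p := sqrt_re c x y) in *.
unfold Re in H2; cbn in H2.
unfold Cmult, Cplus, RtoC in H1; cbn [fst snd] in H1.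
injection H1 as Hre _.
assert (E : p ^ 4 = (x ^ 2 - y ^ 2 + 2 * c) * p ^ 2 + (x * y) ^ 2).
{ replace (x ^ 2 - y ^ 2 + 2 * c) with (p * p - x * y / p * (x * y / p)) by lra.
  field; lra. }
split; [|exact E].
(* [(p^2 - x^2) (p^2 + y^2) = 2 c p^2 > 0] *)
assert (F : (p - x) * ((p + x) * (p ^ 2 + y ^ 2)) = 2 * c * p ^ 2) by nra.
assert (0 < 2 * c * p ^ 2) by (apply Rmult_lt_0_compat; nra).
assert (0 < (p + x) * (p ^ 2 + y ^ 2)) by (apply Rmult_lt_0_compat; nra).
nra.
Qed.

(** [G] has real part [x - p < 0] and imaginary part [y (p - x) / p], so their quotient is [- y / p]
    and the branch of [Carg] with [+ PI] applies. *)
Lemma Carg_G (c x y : R) : 0 < c -> 0 < x ->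
  Carg (G c (x, y)) = PI - atan (y / sqrt_re c x y).
Proof.
intros Hc Hx; destruct (sqrt_re_spec c x y Hc Hx) as [Hp _].
unfold G; rewrite Csqrt_shift_eq by lra.
set (p := sqrt_re c x y) in *.
rewrite Carg_Re_neg; unfold Cminus, Cplus, Copp, Re, Im; cbn [fst snd]; [|lra].
replace ((y + - (x * y / p)) / (x + - p)) with (- (y / p)) by (field; lra).
rewrite atan_opp; ring.
Qed.

Lemma cos_2atan (t : R) : cos (2 * atan t) = (1 - t ^ 2) / (1 + t ^ 2).
Proof.
assert (H : 0 < 1 + t²) by (unfold Rsqr; nra).
rewrite cos_2a_cos, cos_atan.
replace (2 * (1 / sqrt (1 + t²)) * (1 / sqrt (1 + t²)))
  with (2 / (sqrt (1 + t²) * sqrt (1 + t²))).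
- rewrite sqrt_sqrt by lra; unfold Rsqr in *; field; nra.
- field; apply Rgt_not_eq, sqrt_lt_R0, H.
Qed.

Lemma Carg_G_range (c x y : R) : 0 < c -> 0 < x ->
  (0 < y -> PI / 2 < Carg (G c (x, y)) < PI) /\
  (y < 0 -> PI < Carg (G c (x, y)) < 3 * PI / 2).
Proof.
intros Hc Hx; rewrite Carg_G by assumption.
destruct (sqrt_re_spec c x y Hc Hx) as [Hp _].
set (p := sqrt_re c x y) in *.
assert (Hb := atan_bound (y / p)).
assert (Hi : 0 < / p) by (apply Rinv_0_lt_compat; lra).
split; intros Hy; (split; [|]); try lra.
- assert (H : atan 0 < atan (y / p)) by (apply atan_increasing; unfold Rdiv; nra).
  rewrite atan_0 in H; lra.
- assert (H : atan (y / p) < atan 0) by (apply atan_increasing; unfold Rdiv; nra).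
  rewrite atan_0 in H; lra.
Qed.

(** * Level curves of [arg G] as hyperbolas *)

(** The level curves of [arg G] are branches of hyperbolas with foci
    [+- i sqrt (2 c)]; this is
    [y^2 / sin^2 theta - x^2 / cos^2 theta = 2 c] in terms of [cos (2 theta)]. *)
Definition hyperbola (c x y u : R) : Prop :=
  y ^ 2 * (1 + u) - x ^ 2 * (1 - u) = c * (1 - u ^ 2).

(** Here [cos (2 theta) = (p^2 - y^2) / (p^2 + y^2)]; up to a factor [2 y^2], clearing denominators
    leaves [(p^2 - x^2) (p^2 + y^2) = 2 c p^2], the quartic of [sqrt_re_spec] rearranged. *)
Lemma Carg_G_hyperbola (c x y : R) : 0 < c -> 0 < x ->
  hyperbola c x y (cos (2 * Carg (G c (x, y)))).
Proof.
intros Hc Hx; rewrite Carg_G by assumption.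
destruct (sqrt_re_spec c x y Hc Hx) as [Hp E].
set (p := sqrt_re c x y) in *.
replace (2 * (PI - atan (y / p))) with (- (2 * atan (y / p)) + 2 * PI) by ring.
rewrite cos_plus, cos_2PI, sin_2PI, cos_neg, cos_2atan.
unfold hyperbola.
assert (Hq : 0 < p ^ 2 + y ^ 2) by nra.
apply (Rmult_eq_reg_r ((p ^ 2 + y ^ 2) ^ 2)); [|apply pow_nonzero; lra].
replace ((1 - (y / p) ^ 2) / (1 + (y / p) ^ 2))
  with ((p ^ 2 - y ^ 2) / (p ^ 2 + y ^ 2)) by (field; split; nra).
rewrite Rmult_0_r, Rminus_0_r, Rmult_1_r.
transitivity (2 * y ^ 2 * (p ^ 2 + y ^ 2) * (p ^ 2 - x ^ 2)); [field; lra|].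
transitivity (4 * c * p ^ 2 * y ^ 2); [|field; lra].
assert (2 * c * p ^ 2 = (p ^ 2 + y ^ 2) * (p ^ 2 - x ^ 2)) by nra.
nra.
Qed.

(** Eliminating [c] between the two equations leaves [u - w] times a positive factor equal to
    zero. *)
Lemma hyperbola_unique (c x y u w : R) : 0 < x -> y <> 0 ->
  -1 < u < 1 -> -1 < w < 1 -> hyperbola c x y u -> hyperbola c x y w -> u = w.
Proof.
unfold hyperbola; intros Hx Hy Hu Hw Eu Ew.
assert (Hy2 : 0 < y ^ 2) by (apply pow2_gt_0, Hy).
assert (E : (u - w) * (y ^ 2 * ((1 + u) * (1 + w)) + x ^ 2 * ((1 - u) * (1 - w))) = 0).
{ replace (_ * _)
    with ((y ^ 2 * (1 + u) - x ^ 2 * (1 - u)) * (1 - w ^ 2)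
          - (y ^ 2 * (1 + w) - x ^ 2 * (1 - w)) * (1 - u ^ 2)) by ring.
  rewrite Eu, Ew; ring. }
apply Rmult_integral in E; destruct E as [E | E]; [lra|].
assert (0 < y ^ 2 * ((1 + u) * (1 + w))) by (apply Rmult_lt_0_compat; nra).
assert (0 < x ^ 2 * ((1 - u) * (1 - w))) by (apply Rmult_lt_0_compat; nra).
lra.
Qed.

Lemma cos_2X_bound (t : R) : PI / 2 < t < PI -> -1 < cos (2 * t) < 1.
Proof.
intros Ht; assert (H := PI_RGT_0).
rewrite <- cos_PI, <- cos_2PI; split; apply cos_increasing_1; lra.
Qed.

(** The reflection [t -> 2 PI - t] carries this quadrant to the one of [X] and preserves
    [cos (2 t)]. *)
Lemma cos_2Y_bound (t : R) : PI < t < 3 * PI / 2 -> -1 < cos (2 * t) < 1.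
Proof.
intros Ht; assert (H := PI_RGT_0).
replace (cos (2 * t)) with (cos (2 * (2 * PI - t))).
- apply cos_2X_bound; lra.
- replace (2 * (2 * PI - t)) with (- (2 * t) + 2 * INR 2 * PI) by (simpl; ring).
  now rewrite cos_period, cos_neg.
Qed.

Lemma cos_2X_inj (s t : R) :
  PI / 2 < s < PI -> PI / 2 < t < PI -> cos (2 * s) = cos (2 * t) -> s = t.
Proof.
intros Hs Ht E; assert (H := PI_RGT_0).
destruct (Rtotal_order s t) as [L | [L | L]]; [|exact L|].
- assert (cos (2 * s) < cos (2 * t)) by (apply cos_increasing_1; lra); lra.
- assert (cos (2 * t) < cos (2 * s)) by (apply cos_increasing_1; lra); lra.
Qed.

Lemma cos_2Y_inj (s t : R) :
  PI < s < 3 * PI / 2 -> PI < t < 3 * PI / 2 -> cos (2 * s) = cos (2 * t) -> s = t.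
Proof.
intros Hs Ht E; assert (H := PI_RGT_0).
assert (F : forall r, cos (2 * (2 * PI - r)) = cos (2 * r)).
{ intros r.
  replace (2 * (2 * PI - r)) with (- (2 * r) + 2 * INR 2 * PI) by (simpl; ring).
  now rewrite cos_period, cos_neg. }
assert (2 * PI - s = 2 * PI - t) by (apply cos_2X_inj; [lra | lra | now rewrite !F]).
lra.
Qed.

(** [hyperbola_unique] identifies the cosines, and [cos (2 t)] is injective on the quadrant
    containing both angles. *)
Lemma Carg_G_upper (c x y t : R) : 0 < c -> 0 < x -> 0 < y ->
  PI / 2 < t < PI -> hyperbola c x y (cos (2 * t)) -> Carg (G c (x, y)) = t.
Proof.
intros Hc Hx Hy Ht E.
assert (Hr := proj1 (Carg_G_range c x y Hc Hx) Hy).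
apply cos_2X_inj; auto.
apply (hyperbola_unique c x y); auto using cos_2X_bound, Carg_G_hyperbola; lra.
Qed.

Lemma Carg_G_lower (c x y t : R) : 0 < c -> 0 < x -> y < 0 ->
  PI < t < 3 * PI / 2 -> hyperbola c x y (cos (2 * t)) -> Carg (G c (x, y)) = t.
Proof.
intros Hc Hx Hy Ht E.
assert (Hr := proj2 (Carg_G_range c x y Hc Hx) Hy).
apply cos_2Y_inj; auto.
apply (hyperbola_unique c x y); auto using cos_2Y_bound, Carg_G_hyperbola; lra.
Qed.

(** * The explicit inverse map *)

(** The smaller root [t] of [(u - t) (w - t) = c^2 (1 - u^2) (1 - w^2)]. *)
Definition cos_2arg (c u w : R) : R :=
  (u + w - sqrt ((u - w) * (u - w) + 4 * (c * c) * (1 - u * u) * (1 - w * w))) / 2.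

Lemma disc_pos (c u w : R) : 0 < c -> -1 < u < 1 -> -1 < w < 1 ->
  0 < 4 * (c * c) * (1 - u * u) * (1 - w * w).
Proof. intros; repeat apply Rmult_lt_0_compat; nra. Qed.

Lemma cos_2arg_spec (c u w : R) : 0 < c <= 1 / 2 -> -1 < u < 1 -> -1 < w < 1 ->
  (u - cos_2arg c u w) * (w - cos_2arg c u w) = c ^ 2 * (1 - u ^ 2) * (1 - w ^ 2) /\
  -1 < cos_2arg c u w < 1 /\ cos_2arg c u w < u /\ cos_2arg c u w < w.
Proof.
intros Hc Hu Hw.
assert (HD := disc_pos c u w (proj1 Hc) Hu Hw).
unfold cos_2arg.
set (D := (u - w) * (u - w) + 4 * (c * c) * (1 - u * u) * (1 - w * w)).
assert (HD0 : (u - w) * (u - w) < D) by (unfold D; lra).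
assert (Hsq := Rle_0_sqr (u - w)); unfold Rsqr in Hsq.
assert (HsD : sqrt D * sqrt D = D) by (apply sqrt_sqrt, Rlt_le, Rle_lt_trans with (1 := Hsq), HD0).
assert (Hs0 := sqrt_pos D).
remember ((u + w - sqrt D) / 2) as T eqn:ET.
(* Expressing [sqrt D] through [T] leaves only polynomial facts: the quadratic equation and
   [0 <= (u - T) + (w - T)]. *)
assert (HT : sqrt D = u + w - 2 * T) by (rewrite ET; field).
rewrite HT in HsD, Hs0; clear ET HT.
assert (E : (u - T) * (w - T) = c ^ 2 * (1 - u ^ 2) * (1 - w ^ 2)) by (unfold D in HsD; lra).
assert (P : 0 < (u - T) * (w - T)) by (rewrite E; nra).
(* The factors have equal signs by [P] and a nonnegative sum [sqrt D], so both are positive. *)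
assert (Lu : T < u) by (unfold D in *; nra).
assert (Lw : T < w) by nra.
repeat split; try assumption; try lra.
(* If [T <= -1], then [(1 + u) (1 + w)] is at most the product, which is that quantity times
   [c^2 (1 - u) (1 - w)]; the bound [c <= 1 / 2] makes this factor less than 1. *)
apply Rnot_le_lt; intros LT.
assert (K : (1 + u) * (1 + w) <= (u - T) * (w - T)) by (apply Rmult_le_compat; lra).
assert (Q : 0 < (1 + u) * (1 + w)) by (apply Rmult_lt_0_compat; lra).
assert (S : c ^ 2 * ((1 - u) * (1 - w)) < 1).
{ assert (0 < (1 - u) * (1 - w) < 4) by nra.
  assert (0 < c ^ 2 <= 1 / 4) by nra.
  nra. }
rewrite E in K.
replace (c ^ 2 * (1 - u ^ 2) * (1 - w ^ 2))
  with ((c ^ 2 * ((1 - u) * (1 - w))) * ((1 + u) * (1 + w))) in K by ring.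
nra.
Qed.

(** The discriminant is [(u + w - 2 T)^2], and [T] below both [u] and [w] fixes the sign of its
    root. *)
Lemma cos_2arg_unique (c u w T : R) : T < u -> T < w ->
  (u - T) * (w - T) = c ^ 2 * (1 - u ^ 2) * (1 - w ^ 2) -> cos_2arg c u w = T.
Proof.
intros Hu Hw E; unfold cos_2arg.
replace (_ + 4 * (c * c) * (1 - u * u) * (1 - w * w)) with (Rsqr (u + w - 2 * T)).
- rewrite sqrt_Rsqr by lra; field.
- unfold Rsqr; nra.
Qed.

(** With [m = |z|^2] and [T = cos (2 arg z)] the hypotheses are the half-angle formulas, and the
    left side of [hyperbola] collapses to [m (u - T)]. *)
Lemma hyperbola_polar (c x y m T u : R) : 0 < c -> -1 < u < 1 ->
  x ^ 2 = m * (1 + T) / 2 -> y ^ 2 = m * (1 - T) / 2 ->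
  hyperbola c x y u <-> m * (u - T) = c * (1 - u ^ 2).
Proof.
intros Hc Hu Hx Hy; unfold hyperbola; rewrite Hx, Hy.
split; intros H; rewrite <- H; field.
Qed.

(** This is [|z|^2], solved from the equation for [1 / z]. *)
Definition modulus_sqr (c u w : R) : R := (w - cos_2arg c u w) / (c * (1 - w * w)).

(** The coordinates are [|z| cos (arg z)] and [|z| sin (arg z)] by the half-angle formulas, with
    positive roots for the first quadrant. *)
Definition zinv (c : R) (q : R * R) : C :=
  let u := cos (2 * fst q) in
  let w := cos (2 * snd q) in
  (sqrt (modulus_sqr c u w * (1 + cos_2arg c u w) / 2),
   sqrt (modulus_sqr c u w * (1 - cos_2arg c u w) / 2)).

(** The equation for [1 / z] defines the modulus; the one for [z] then follows from the product
    equation of [cos_2arg_spec]. *)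
Lemma modulus_sqr_spec (c u w : R) : 0 < c <= 1 / 2 -> -1 < u < 1 -> -1 < w < 1 ->
  0 < modulus_sqr c u w /\
  modulus_sqr c u w * (u - cos_2arg c u w) = c * (1 - u ^ 2) /\
  w - cos_2arg c u w = c * (1 - w ^ 2) * modulus_sqr c u w.
Proof.
intros Hc Hu Hw.
destruct (cos_2arg_spec c u w Hc Hu Hw) as [E [HT [Lu Lw]]].
assert (Hd : 0 < c * (1 - w * w)) by (apply Rmult_lt_0_compat; nra).
assert (c <> 0 /\ 1 - w * w <> 0) by (split; nra).
unfold modulus_sqr; repeat split.
- apply Rdiv_lt_0_compat; lra.
- replace (_ * _) with ((u - cos_2arg c u w) * (w - cos_2arg c u w) / (c * (1 - w * w)))
    by (field; tauto).
  rewrite E; field; tauto.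
- field; tauto.
Qed.

Lemma RtoC_1_div (x y : R) :
  (RtoC 1 / (x, y))%C = (x / (x * x + y * y), - y / (x * x + y * y)).
Proof.
unfold Cdiv; rewrite Cmult_1_l; unfold Cinv; cbn [fst snd].
f_equal; f_equal; ring.
Qed.

Lemma zinv_pos (c X Y : R) : 0 < c <= 1 / 2 -> XYrange (X, Y) ->
  let m := modulus_sqr c (cos (2 * X)) (cos (2 * Y)) in
  let T := cos_2arg c (cos (2 * X)) (cos (2 * Y)) in
  0 < m * (1 + T) / 2 /\ 0 < m * (1 - T) / 2.
Proof.
intros Hc [HX HY] m T; cbn [fst snd] in HX, HY.
apply cos_2X_bound in HX; apply cos_2Y_bound in HY.
destruct (cos_2arg_spec c _ _ Hc HX HY) as [_ [HT _]].
destruct (modulus_sqr_spec c _ _ Hc HX HY) as [Hm _].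
fold m in Hm; fold T in HT; split; nra.
Qed.

Lemma Qplus_zinv (c : R) (q : R * R) : 0 < c <= 1 / 2 -> XYrange q -> Qplus (zinv c q).
Proof.
destruct q as [X Y]; intros Hc Hq.
destruct (zinv_pos c X Y Hc Hq).
split; unfold Re, Im; cbn; now apply sqrt_lt_R0.
Qed.

(** [1 / z] lies in the open fourth quadrant, which [G] sends to the third. *)
Lemma XYrange_XY (c : R) (z : C) : 0 < c -> Qplus z -> XYrange (XY c z).
Proof.
destruct z as [x y]; intros Hc [Hx Hy]; unfold Re, Im in Hx, Hy; cbn [fst snd] in Hx, Hy.
unfold XY, XYrange; cbn [fst snd]; rewrite RtoC_1_div.
assert (Hm : 0 < x * x + y * y) by nra.
assert (Hx' : 0 < x / (x * x + y * y)) by (apply Rdiv_lt_0_compat; lra).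
assert (Hy' : - y / (x * x + y * y) < 0).
{ assert (0 < y / (x * x + y * y)) by (apply Rdiv_lt_0_compat; lra).
  unfold Rdiv in *; lra. }
split.
- apply Carg_G_range; auto.
- apply Carg_G_range; auto.
Qed.

Lemma XY_zinv (c : R) (q : R * R) : 0 < c <= 1 / 2 -> XYrange q -> XY c (zinv c q) = q.
Proof.
destruct q as [X Y]; intros Hc Hq.
assert (Hp := Qplus_zinv c (X, Y) Hc Hq).
destruct (zinv_pos c X Y Hc Hq) as [P1 P2].
destruct Hq as [HX HY]; cbn [fst snd] in HX, HY.
assert (HX' := cos_2X_bound X HX); assert (HY' := cos_2Y_bound Y HY).
destruct (modulus_sqr_spec c _ _ Hc HX' HY') as [Hm [E1 E2]].
set (m := modulus_sqr c (cos (2 * X)) (cos (2 * Y))) in *.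
set (T := cos_2arg c (cos (2 * X)) (cos (2 * Y))) in *.
change (zinv c (X, Y)) with (sqrt (m * (1 + T) / 2), sqrt (m * (1 - T) / 2)) in *.
assert (S1 := pow2_sqrt _ (Rlt_le _ _ P1)).
assert (S2 := pow2_sqrt _ (Rlt_le _ _ P2)).
destruct Hp as [Hx Hy]; unfold Re, Im in Hx, Hy; cbn [fst snd] in Hx, Hy.
set (x := sqrt (m * (1 + T) / 2)) in *; set (y := sqrt (m * (1 - T) / 2)) in *.
assert (M : x * x + y * y = m) by nra.
unfold XY; rewrite RtoC_1_div, M.
f_equal.
- apply Carg_G_upper; try lra.
  apply (hyperbola_polar c x y m T); auto; lra.
- apply Carg_G_lower; try lra.
  + apply Rdiv_lt_0_compat; lra.
  + assert (0 < y / m) by (apply Rdiv_lt_0_compat; lra); unfold Rdiv in *; lra.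
  (* [1 / z] has squared modulus [/ m] and the opposite argument, so the same [T] serves. *)
  + apply (hyperbola_polar c _ _ (/ m) T); try lra.
    * unfold Rdiv; rewrite Rpow_mult_distr, S1; field; lra.
    * replace (- y / m) with (- (y * / m)) by (unfold Rdiv; ring).
      replace ((- (y * / m)) ^ 2) with (y ^ 2 * (/ m) ^ 2) by ring.
      rewrite S2; field; lra.
    * rewrite E2; field; lra.
Qed.

Lemma zinv_XY (c : R) (z : C) : 0 < c <= 1 / 2 -> Qplus z -> zinv c (XY c z) = z.
Proof.
intros Hc Hz; destruct (XYrange_XY c z (proj1 Hc) Hz) as [HX HY].
destruct z as [x y]; destruct Hz as [Hx Hy]; unfold Re, Im in Hx, Hy; cbn [fst snd] in Hx, Hy.
unfold XY in *; rewrite RtoC_1_div in *; cbn [fst snd] in HX, HY.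
set (m := x * x + y * y) in *.
assert (Hm : 0 < m) by (unfold m; nra).
assert (Hx' : 0 < x / m) by (apply Rdiv_lt_0_compat; lra).
assert (E1 := Carg_G_hyperbola c x y (proj1 Hc) Hx).
assert (E2 := Carg_G_hyperbola c (x / m) (- y / m) (proj1 Hc) Hx').
apply cos_2X_bound in HX; apply cos_2Y_bound in HY.
unfold zinv; cbn [fst snd].
set (u := cos (2 * Carg (G c (x, y)))) in *.
set (w := cos (2 * Carg (G c (x / m, - y / m)))) in *.
set (T := (x ^ 2 - y ^ 2) / m).
assert (S1 : x ^ 2 = m * (1 + T) / 2) by (unfold T, m in *; field; lra).
assert (S2 : y ^ 2 = m * (1 - T) / 2) by (unfold T, m in *; field; lra).
apply (hyperbola_polar c x y m T) in E1; auto; [|lra].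
apply (hyperbola_polar c (x / m) (- y / m) (/ m) T) in E2; auto; try lra.
2: { unfold Rdiv; rewrite Rpow_mult_distr, S1; field; lra. }
2: { replace (- y / m) with (- (y * / m)) by (unfold Rdiv; ring).
     replace ((- (y * / m)) ^ 2) with (y ^ 2 * (/ m) ^ 2) by ring.
     rewrite S2; field; lra. }
assert (E2' : w - T = c * (1 - w ^ 2) * m) by (rewrite <- E2; field; lra).
(* Positivity of [m] puts [T = cos (2 arg z)] below both [u] and [w], so it is the smaller root. *)
assert (Lu : T < u).
{ assert (0 < c * (1 - u ^ 2)) by (apply Rmult_lt_0_compat; nra); nra. }
assert (Lw : T < w).
{ assert (0 < c * (1 - w ^ 2) * m) by (repeat apply Rmult_lt_0_compat; nra); nra. }
assert (ET : cos_2arg c u w = T).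
{ apply cos_2arg_unique; auto.
  rewrite E2'.
  replace ((u - T) * (c * (1 - w ^ 2) * m)) with (m * (u - T) * (c * (1 - w ^ 2))) by ring.
  rewrite E1; ring. }
assert (Em : modulus_sqr c u w = m).
{ unfold modulus_sqr; rewrite ET, E2'; field; split; nra. }
rewrite ET, Em, <- S1, <- S2, !sqrt_pow2 by lra; reflexivity.
Qed.

(** [acos T / 2] lies in (0, PI/2), and its cosine and sine are the square roots of [(1 + T) / 2]
    and [(1 - T) / 2]; uniqueness of the argument concludes. *)
Lemma Carg_zinv (c : R) (q : R * R) : 0 < c <= 1 / 2 -> XYrange q ->
  Carg (zinv c q) = acos (cos_2arg c (cos (2 * fst q)) (cos (2 * snd q))) / 2.
Proof.
destruct q as [X Y]; intros Hc Hq.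
assert (Hp := Qplus_zinv c (X, Y) Hc Hq).
destruct (zinv_pos c X Y Hc Hq) as [P1 P2].
destruct Hq as [HX HY]; cbn [fst snd] in HX, HY.
assert (HX' := cos_2X_bound X HX); assert (HY' := cos_2Y_bound Y HY).
destruct (modulus_sqr_spec c _ _ Hc HX' HY') as [Hm _].
destruct (cos_2arg_spec c _ _ Hc HX' HY') as [_ [HT _]].
unfold zinv in *; cbn [fst snd] in *.
set (m := modulus_sqr c (cos (2 * X)) (cos (2 * Y))) in *.
set (T := cos_2arg c (cos (2 * X)) (cos (2 * Y))) in *.
assert (HPI := PI_RGT_0).
assert (Hb := acos_bound_lt T HT).
assert (Hc2 : cos (2 * (acos T / 2)) = T).
{ replace (2 * (acos T / 2)) with (acos T) by field; apply cos_acos; lra. }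
assert (HC : 0 < cos (acos T / 2)) by (apply cos_gt_0; lra).
assert (HS : 0 <= sin (acos T / 2)) by (apply sin_ge_0; lra).
assert (EC := Hc2); rewrite cos_2a_cos in EC.
assert (ES := Hc2); rewrite cos_2a_sin in ES.
assert (Hmod : Cmod (sqrt (m * (1 + T) / 2), sqrt (m * (1 - T) / 2)) = sqrt m).
{ unfold Cmod; cbn [fst snd]; rewrite !pow2_sqrt by lra; f_equal; field. }
symmetry; apply Carg_unique; [| lra | |].
- intros E; apply (f_equal Re) in E; destruct Hp as [Hp _]; rewrite E in Hp.
  unfold Re in Hp; cbn in Hp; lra.
- rewrite Hmod; unfold Re; cbn [fst].
  replace (m * (1 + T) / 2) with (m * Rsqr (cos (acos T / 2))) by (unfold Rsqr; nra).
  rewrite sqrt_mult, sqrt_Rsqr by (try apply Rle_0_sqr; lra); reflexivity.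
- rewrite Hmod; unfold Im; cbn [snd].
  replace (m * (1 - T) / 2) with (m * Rsqr (sin (acos T / 2))) by (unfold Rsqr; nra).
  rewrite sqrt_mult, sqrt_Rsqr by (try apply Rle_0_sqr; lra); reflexivity.
Qed.

(** * Smoothness of the map and of its inverse *)

Lemma Qplus_open (x y : R) : Qplus (x, y) -> locally_2d (fun u v => Qplus (u, v)) x y.
Proof.
intros [Hx Hy]; unfold Re, Im in Hx, Hy; cbn [fst snd] in Hx, Hy.
exists (mkposreal _ (Rmin_pos _ _ Hx Hy)); cbn [pos]; intros u v Hu Hv.
assert (H1 := Rmin_l x y); assert (H2 := Rmin_r x y).
apply Rabs_def2 in Hu; apply Rabs_def2 in Hv.
split; unfold Re, Im; cbn [fst snd]; lra.
Qed.

Lemma XYrange_open (x y : R) :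
  XYrange (x, y) -> locally_2d (fun u v => XYrange (u, v)) x y.
Proof.
intros [[Hx1 Hx2] [Hy1 Hy2]]; cbn [fst snd] in *.
assert (Hd : 0 < Rmin (Rmin (x - PI / 2) (PI - x)) (Rmin (y - PI) (3 * PI / 2 - y)))
  by (repeat apply Rmin_pos; lra).
exists (mkposreal _ Hd); cbn [pos]; intros u v Hu Hv.
assert (H1 := Rmin_l (Rmin (x - PI / 2) (PI - x)) (Rmin (y - PI) (3 * PI / 2 - y))).
assert (H2 := Rmin_r (Rmin (x - PI / 2) (PI - x)) (Rmin (y - PI) (3 * PI / 2 - y))).
assert (H3 := Rmin_l (x - PI / 2) (PI - x)); assert (H4 := Rmin_r (x - PI / 2) (PI - x)).
assert (H5 := Rmin_l (y - PI) (3 * PI / 2 - y)); assert (H6 := Rmin_r (y - PI) (3 * PI / 2 - y)).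
apply Rabs_def2 in Hu; apply Rabs_def2 in Hv.
split; cbn [fst snd]; lra.
Qed.

Ltac smooth_n_tac :=
  repeat first
    [ apply smooth_n_fst | apply smooth_n_snd | apply smooth_n_const
    | assumption
    | apply smooth_n_minus | apply smooth_n_plus | apply smooth_n_mult
    | apply smooth_n_cos | apply smooth_n_atan ].

Lemma smooth_n_sqrt_re (U : R * R -> Prop) (c : R) (n : nat) (a b : R -> R -> R) :
  0 < c -> (forall x y, U (x, y) -> 0 < a x y /\ b x y <> 0) ->
  smooth_n U n a -> smooth_n U n b ->
  smooth_n U n (fun x y => sqrt_re c (a x y) (b x y)).
Proof.
intros Hc HU Sa Sb; unfold sqrt_re.
apply smooth_n_sqrt.
(* If the outer radicand were not positive, [sqrt] would return 0, against [0 < a x y < sqrt_re]. *)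
- intros x y H; destruct (HU x y H) as [Ha _].
  destruct (sqrt_re_spec c (a x y) (b x y) Hc Ha) as [Hp _].
  unfold sqrt_re in Hp; apply Rnot_le_lt; intros L.
  rewrite sqrt_neg_0 in Hp by exact L; lra.
- apply smooth_n_div; [intros; lra | | apply smooth_n_const].
  apply smooth_n_plus; [apply smooth_n_sqrt |]; smooth_n_tac.
  (* The inner radicand is a square plus [4 (a b)^2], positive because neither factor vanishes. *)
  intros x y H; destruct (HU x y H) as [Ha Hb].
  apply Rplus_le_lt_0_compat; [apply Rle_0_sqr |].
  assert (0 < Rsqr (a x y * b x y)) by (apply Rsqr_pos_lt, Rmult_integral_contrapositive; lra).
  unfold Rsqr in *; lra.
Qed.

Lemma smooth_on_XY (c : R) : 0 < c -> smooth_on Qplus (XY c).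
Proof.
intros Hc.
assert (HQ : forall x y, Qplus (x, y) -> 0 < x /\ 0 < y) by (intros x y H; exact H).
assert (Hm : forall x y, Qplus (x, y) -> 0 < x * x + y * y).
{ intros x y H; apply HQ in H; nra. }
assert (Hx' : forall x y, Qplus (x, y) -> 0 < x / (x * x + y * y)).
{ intros x y H; assert (H' := HQ x y H); apply Rdiv_lt_0_compat; [lra | auto]. }
assert (Hy' : forall x y, Qplus (x, y) -> - 1 * y / (x * x + y * y) < 0).
{ intros x y H; assert (H' := HQ x y H).
  assert (0 < y / (x * x + y * y)) by (apply Rdiv_lt_0_compat; [lra | auto]).
  unfold Rdiv in *; lra. }
assert (Sa : forall n, smooth_n Qplus n (fun x y => x / (x * x + y * y))).
{ intros n; apply smooth_n_div; smooth_n_tac.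
  intros x y H; apply Rgt_not_eq, Hm, H. }
assert (Sb : forall n, smooth_n Qplus n (fun x y => - 1 * y / (x * x + y * y))).
{ intros n; apply smooth_n_div; smooth_n_tac.
  intros x y H; apply Rgt_not_eq, Hm, H. }
apply (smooth_on_smooth_n Qplus (XY c)
  (fun x y => PI - atan (y / sqrt_re c x y))
  (fun x y => PI - atan ((- 1 * y / (x * x + y * y))
     / sqrt_re c (x / (x * x + y * y)) (- 1 * y / (x * x + y * y))))).
- exact Qplus_open.
- intros x y H; unfold XY; rewrite RtoC_1_div.
  replace (- y) with (- 1 * y) by ring.
  rewrite !Carg_G; auto; apply (HQ x y H).
- intros n; apply smooth_n_minus; [apply smooth_n_const |].
  apply smooth_n_atan, smooth_n_div; [| apply smooth_n_snd |].
  + intros x y H; apply HQ in H.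
    destruct (sqrt_re_spec c x y Hc (proj1 H)); lra.
  + apply (smooth_n_sqrt_re Qplus c n (fun x _ => x) (fun _ y => y)); smooth_n_tac; auto.
    intros x y H; apply HQ in H; lra.
- intros n; apply smooth_n_minus; [apply smooth_n_const |].
  apply smooth_n_atan, smooth_n_div; [| apply Sb |].
  + intros x y H.
    destruct (sqrt_re_spec c _ (- 1 * y / (x * x + y * y)) Hc (Hx' x y H)) as [Hp _].
    specialize (Hx' x y H); lra.
  + apply (smooth_n_sqrt_re Qplus c n (fun x y => x / (x * x + y * y))
      (fun x y => - 1 * y / (x * x + y * y))); auto.
    intros x y H; specialize (Hx' x y H); specialize (Hy' x y H); lra.
Qed.

Lemma smooth_on_zinv (c : R) : 0 < c <= 1 / 2 -> smooth_on XYrange (zinv c).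
Proof.
intros Hc.
set (u := fun X Y : R => cos (2 * X)); set (w := fun X Y : R => cos (2 * Y)).
assert (Hu : forall X Y, XYrange (X, Y) -> -1 < u X Y < 1).
{ intros X Y H; apply cos_2X_bound, H. }
assert (Hw : forall X Y, XYrange (X, Y) -> -1 < w X Y < 1).
{ intros X Y H; apply cos_2Y_bound, H. }
assert (Su : forall n, smooth_n XYrange n u) by (intros n; unfold u; smooth_n_tac).
assert (Sw : forall n, smooth_n XYrange n w) by (intros n; unfold w; smooth_n_tac).
assert (ST : forall n, smooth_n XYrange n (fun X Y => cos_2arg c (u X Y) (w X Y))).
{ intros n; specialize (Su n); specialize (Sw n).
  unfold cos_2arg; apply smooth_n_div; [intros; lra | | apply smooth_n_const].
  apply smooth_n_minus; [| apply smooth_n_sqrt]; smooth_n_tac.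
  (* [u] and [w] stay strictly inside (-1, 1), so the discriminant never vanishes and its root is
     smooth. *)
  intros X Y H; apply Rplus_le_lt_0_compat; [apply Rle_0_sqr |].
  apply disc_pos; [lra | auto | auto]. }
assert (Sm : forall n, smooth_n XYrange n (fun X Y => modulus_sqr c (u X Y) (w X Y))).
{ intros n; specialize (Sw n); specialize (ST n).
  unfold modulus_sqr; apply smooth_n_div; smooth_n_tac.
  intros X Y H; specialize (Hw X Y H).
  apply Rgt_not_eq, Rmult_lt_0_compat; nra. }
apply (smooth_on_smooth_n XYrange (zinv c)
  (fun X Y => sqrt (modulus_sqr c (u X Y) (w X Y) * (1 + cos_2arg c (u X Y) (w X Y)) / 2))
  (fun X Y => sqrt (modulus_sqr c (u X Y) (w X Y) * (1 - cos_2arg c (u X Y) (w X Y)) / 2))).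
- exact XYrange_open.
- reflexivity.
- intros n; specialize (ST n); specialize (Sm n).
  apply smooth_n_sqrt; [intros X Y H; apply (zinv_pos c X Y Hc H) |].
  apply smooth_n_div; [intros; lra | | apply smooth_n_const]; smooth_n_tac.
- intros n; specialize (ST n); specialize (Sm n).
  apply smooth_n_sqrt; [intros X Y H; apply (zinv_pos c X Y Hc H) |].
  apply smooth_n_div; [intros; lra | | apply smooth_n_const]; smooth_n_tac.
Qed.

Lemma diffeomorphism_XY (c : R) : 0 < c <= 1 / 2 ->
  diffeomorphism Qplus XYrange (XY c) (zinv c).
Proof.
intros Hc; unfold diffeomorphism.
split; [intros p; apply XYrange_XY, Hc|].
split; [intros q; apply Qplus_zinv, Hc|].
split; [intros p; apply zinv_XY, Hc|].
split; [intros q; apply XY_zinv, Hc|].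
split; [apply smooth_on_XY, Hc | apply smooth_on_zinv, Hc].
Qed.

(** * The speed of growth and its symmetries *)

(** Since [2 X = rho_- + PI] and [2 Y = 3 PI - rho_+], one has [u = - cos rho_-] and
    [w = - cos rho_+], while [1 - u^2] and [1 - w^2] become squared sines. *)
Lemma cos_2arg_Sigma (c : R) (rho : R * R) :
  cos_2arg c (cos (2 * Xrho rho)) (cos (2 * Yrho rho)) = Sigma c rho.
Proof.
replace (cos (2 * Xrho rho)) with (- cos (rho_minus rho)).
2: { rewrite <- neg_cos; f_equal; unfold Xrho; field. }
replace (cos (2 * Yrho rho)) with (- cos (rho_plus rho)).
2: { rewrite <- neg_cos, <- cos_neg.
     rewrite <- (cos_period _ 2); f_equal; unfold Yrho; simpl; field. }
unfold cos_2arg, Sigma.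
assert (H1 := sin2_cos2 (rho_minus rho)); assert (H2 := sin2_cos2 (rho_plus rho)).
unfold Rsqr in H1, H2.
replace (1 - - cos (rho_minus rho) * - cos (rho_minus rho))
  with (sin (rho_minus rho) ^ 2) by nra.
replace (1 - - cos (rho_plus rho) * - cos (rho_plus rho))
  with (sin (rho_plus rho) ^ 2) by nra.
match goal with |- (_ - sqrt ?a) / 2 = - ((_ + sqrt ?b) / 2) =>
  replace a with b by ring end.
field.
Qed.

(** The sign in [v] is 1, and both sides equal [rho_- / (2 PI) - 1 / 2 + acos Sigma / (2 PI)]. *)
Lemma v_eq_v_alt (c : R) (rho : R * R) : 0 < c <= 1 / 2 ->
  0 < rho_minus rho < PI -> 0 < rho_plus rho < PI ->
  XYrange (Xrho rho, Yrho rho) /\ v c rho = v_alt (zinv c) rho.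
Proof.
intros Hc Hm Hp; assert (HPI := PI_RGT_0).
assert (HR : XYrange (Xrho rho, Yrho rho)).
{ unfold XYrange, Xrho, Yrho; cbn [fst snd]; lra. }
split; [exact HR|].
unfold v_alt; rewrite Carg_zinv by assumption; cbn [fst snd].
rewrite cos_2arg_Sigma; unfold v, Xrho.
rewrite sign_eq_1 by (apply Rmult_lt_0_compat; lra).
field; lra.
Qed.

(** The exchange negates [rho_-] and fixes [rho_+]; [Sigma] is even in [rho_-], so both terms of [v]
    change sign. *)
Lemma v_swap (c rho1 rho2 : R) : v c (rho1, rho2) = - v c (rho2, rho1).
Proof.
assert (Hm : rho_minus (rho2, rho1) = - rho_minus (rho1, rho2))
  by (unfold rho_minus; cbn; ring).
assert (Hp : rho_plus (rho2, rho1) = rho_plus (rho1, rho2))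
  by (unfold rho_plus; cbn; ring).
unfold v, Sigma; rewrite Hm, Hp, cos_neg, sin_neg, Ropp_mult_distr_l_reverse, sign_opp.
replace ((- sin (rho_minus (rho1, rho2))) ^ 2) with (sin (rho_minus (rho1, rho2)) ^ 2) by ring.
assert (HPI := PI_RGT_0); field; lra.
Qed.

(** The reflection fixes [rho_-] and negates [rho_+]: only the term with the sign flips, so the two
    speeds add up to [rho_- / PI = rho1 - rho2]. *)
Lemma v_reflect (c rho1 rho2 : R) :
  v c (rho1, rho2) = rho1 - rho2 - v c (- rho2, - rho1).
Proof.
assert (Hm : rho_minus (- rho2, - rho1) = rho_minus (rho1, rho2))
  by (unfold rho_minus; cbn; ring).
assert (Hp : rho_plus (- rho2, - rho1) = - rho_plus (rho1, rho2))
  by (unfold rho_plus; cbn; ring).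
unfold v, Sigma; rewrite Hm, Hp, cos_neg, sin_neg, Ropp_mult_distr_r_reverse, sign_opp.
replace ((- sin (rho_plus (rho1, rho2))) ^ 2) with (sin (rho_plus (rho1, rho2)) ^ 2) by ring.
replace (rho1 - rho2) with (rho_minus (rho1, rho2) / PI)
  by (unfold rho_minus; cbn; field; apply PI_neq0).
field; apply PI_neq0.
Qed.

Theorem theorem3p12 (a c : R) (ha : 0 < a <= 1) (hc : c = a / (1 + a ^ 2)) :
  exists zXY : R * R -> C,
    diffeomorphism Qplus XYrange (XY c) zXY /\
    (forall rho : R * R, slope rho ->
       0 < rho_minus rho < PI -> 0 < rho_plus rho < PI ->
       XYrange (Xrho rho, Yrho rho) /\ v c rho = v_alt zXY rho) /\
    (forall rho1 rho2 : R, slope (rho1, rho2) ->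
       v c (rho1, rho2) = - v c (rho2, rho1) /\
       v c (rho1, rho2) = rho1 - rho2 - v c (- rho2, - rho1)) /\
    (forall rho1 rho2 : R, slope (rho1, rho2) ->
       - PI < rho_minus (rho1, rho2) < 0 -> 0 < rho_plus (rho1, rho2) < PI ->
       v c (rho1, rho2) = - v_alt zXY (rho2, rho1)) /\
    (forall rho1 rho2 : R, slope (rho1, rho2) ->
       - PI < rho_plus (rho1, rho2) < 0 -> 0 < rho_minus (rho1, rho2) < PI ->
       v c (rho1, rho2) = rho1 - rho2 - v_alt zXY (- rho2, - rho1)) /\
    (forall rho1 rho2 : R, slope (rho1, rho2) ->
       - PI < rho_minus (rho1, rho2) < 0 -> - PI < rho_plus (rho1, rho2) < 0 ->
       v c (rho1, rho2) = rho1 - rho2 + v_alt zXY (- rho1, - rho2)).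
Proof.
assert (Hc : 0 < c <= 1 / 2).
{ assert (Ha : 0 < 1 + a ^ 2) by nra.
  rewrite hc; split; [apply Rdiv_lt_0_compat; lra|].
  (* The bound [c <= 1 / 2] amounts to [0 <= (1 - a)^2]. *)
  apply (Rmult_le_reg_r (1 + a ^ 2)); [exact Ha|].
  unfold Rdiv; rewrite Rmult_assoc, Rinv_l by lra; nra. }
clear ha hc.
exists (zinv c).
split; [apply diffeomorphism_XY, Hc|].
split; [intros rho _; apply v_eq_v_alt, Hc|].
split; [intros rho1 rho2 _; split; [apply v_swap | apply v_reflect]|].
assert (Hv : forall rho1 rho2, 0 < rho_minus (rho1, rho2) < PI ->
  0 < rho_plus (rho1, rho2) < PI -> v_alt (zinv c) (rho1, rho2) = v c (rho1, rho2)).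
{ intros rho1 rho2 Hm Hp; symmetry; now apply v_eq_v_alt. }
unfold rho_minus, rho_plus in *; cbn [fst snd] in *.
split; [|split]; intros rho1 rho2 _ H1 H2; rewrite Hv by lra.
- apply v_swap.
- apply v_reflect.
(* The exchange followed by the reflection is the point symmetry [rho -> - rho]. *)
- rewrite v_swap, v_reflect; ring.
Qed.
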